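(* Stable Voting (SV) satisfies stability for winners with tiebreaking. That is, for every profile $\mathbf{P}$: if there is a candidate who is stable for SV in $\mathbf{P}$, then every SV winner in $\mathbf{P}$ is stable for SV in $\mathbf{P}$.
   Context: A profile $\mathbf{P}$ is an assignment, to each voter in a finite electorate, of a ranking of a finite nonempty set of candidates; rankings may contain ties and may be incomplete (a ranking may be regarded as a strict weak order of all candidates, with unranked candidates tied below all ranked ones). For distinct candidates $A,B$, the margin of $A$ vs. $B$ in $\mathbf{P}$ is the number of voters who rank $A$ above $B$ minus the number who rank $B$ above $A$. $A$ beats $B$ head-to-head if the margin of $A$ vs. $B$ is positive. A match $A$ vs. $B$ is an ordered pair of distinct candidates. For a candidate $B$, $\mathbf{P}_{-B}$ is the profile obtained from $\mathbf{P}$ by removing $B$ from all rankings. Defeat: for distinct candidates $A,B$, $B$ does not defeat $A$ in $\mathbf{P}$ if there is a list of candidates $X_1,\dots,X_n$ in $\mathbf{P}$ with $X_1=A$, $X_n=B$ such that for each $i<n$ the margin of $X_i$ vs. $X_{i+1}$ is at least the margin of $B$ vs. $A$; otherwise $B$ defeats $A$. Stable Voting (SV) is defined recursively on the number of candidates. If $\mathbf{P}$ has only one candidate, that candidate is the unique SV winner. Otherwise, call a match $A$ vs. $B$ eligible if $A$ is an SV winner in $\mathbf{P}_{-B}$ and $B$ does not defeat $A$ in $\mathbf{P}$. Then $A$ is an SV winner in $\mathbf{P}$ if and only if there is some $B$ such that $A$ vs. $B$ is eligible and the margin of $A$ vs. $B$ is maximal among the margins of all eligible matches (there may be several tied SV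 winners). Stability: given a voting method $\mathsf{M}$ and profile $\mathbf{P}$, a candidate $A$ is stable for $\mathsf{M}$ in $\mathbf{P}$ if there is some candidate $B$ in $\mathbf{P}$ whom $A$ beats head-to-head in $\mathbf{P}$ such that $A$ is a winner according to $\mathsf{M}$ in $\mathbf{P}_{-B}$. $\mathsf{M}$ satisfies stability for winners with tiebreaking if for every profile $\mathbf{P}$, if there is a candidate who is stable for $\mathsf{M}$ in $\mathbf{P}$, then every winner in $\mathbf{P}$ according to $\mathsf{M}$ is stable for $\mathsf{M}$ in $\mathbf{P}$. *)

(* Defs.v *)
From mathcomp Require Import all_boot all_order all_algebra.

Set Implicit Arguments.
Unset Strict Implicit.
Unset Printing Implicit Defensive.

Import Order.TTheory GRing.Theory Num.Theory.
Local Open Scope ring_scope.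

(* The second clause is negative transitivity, in contrapositive form. *)
Definition strict_weak_order (C : Type) (r : rel C) : Prop :=
  (forall x y, r x y -> ~~ r y x) /\
  (forall x y z, r x z -> r x y || r y z).

(* [above r x y]: x is ranked strictly above y.  Ties are incomparable pairs;
   in an incomplete ranking the unranked candidates are tied at the bottom. *)
Record ranking (C : Type) := Ranking {
  above :> rel C;
  aboveP : strict_weak_order above
}.

(* The voters are the elements of V and the candidates are those of C.  That
   there is at least one candidate is assumed where it is needed. *)
Definition profile (V C : finType) := V -> ranking C.

Definition margin (V C : finType) (P : profile V C) (A B : C) : int :=
  #|[set v | P v A B]|%:Z - #|[set v | P v B A]|%:Z.

Definition beats (V C : finType) (P : profile V C) (A B : C) : bool :=
  0 < margin P A B.

Lemma strict_weak_order_preim (C D : Type) (f : D -> C) (r : ranking C) :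
  strict_weak_order (fun x y : D => r (f x) (f y)).
Proof. by case: r => r [ras rnt]; split=> [x y|x y z]; [apply: ras|apply: rnt]. Qed.

Definition ranking_preim (C D : Type) (f : D -> C) (r : ranking C) : ranking D :=
  Ranking (strict_weak_order_preim f r).

(* The profile P_{-B}: its candidates form the subtype of C omitting B. *)
Definition remove (V C : finType) (P : profile V C) (B : C) :
    profile V {x : C | x != B} :=
  fun v => ranking_preim val (P v).

(* [connect e A B] holds iff there is a finite list from A to B whose
   consecutive elements are related by e. *)
Definition defeats (V C : finType) (P : profile V C) (B A : C) : bool :=
  ~~ connect (fun X Y => margin P B A <= margin P X Y) A B.

Definition voting_method := forall V C : finType, profile V C -> {set C}.

(* The M-winners of P_{-B}, viewed as candidates of P. *)
Definition winners_without (V C : finType)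
    (M : forall D : finType, profile V D -> {set D})
    (P : profile V C) (B : C) : {set C} :=
  [set val x | x in M _ (remove P B)].

Definition eligible (V C : finType)
    (M : forall D : finType, profile V D -> {set D})
    (P : profile V C) (A B : C) : bool :=
  [&& A != B, A \in winners_without M P B & ~~ defeats P B A].

Definition SV_step (V C : finType)
    (M : forall D : finType, profile V D -> {set D})
    (P : profile V C) : {set C} :=
  [set A | [exists B, eligible M P A B &&
     [forall A', forall B',
        eligible M P A' B' ==> (margin P A' B' <= margin P A B)]]].

(* n is the number of candidates; see SVE for the recursion without it. *)
Fixpoint SV_rec (V : finType) (n : nat) (C : finType) (P : profile V C)
    : {set C} :=
  match n with
  | 0 => set0
  | 1 => setT
  | k.+1 => SV_step (@SV_rec V k) P
  end.

Definition SV : voting_method := fun V C P => SV_rec #|C| P.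

Lemma SVE (V C : finType) (P : profile V C) :
  (0 < #|C|)%N ->
  SV P = if #|C| == 1%N then setT else SV_step (@SV V) P.
Proof.
rewrite /SV; case En: #|C| => [//|[//|n]] _ /=.
have EW B : winners_without (@SV_rec V n.+1) P B = winners_without (@SV V) P B.
  have card_sub: #|{: {x : C | x != B}}| = n.+1.
    by rewrite card_sig -[n.+1]/(n.+2.-1) -En (cardC1 B).
  by rewrite /winners_without /SV card_sub.
have Eel A B : eligible (@SV_rec V n.+1) P A B = eligible (@SV V) P A B.
  by rewrite /eligible EW.
apply/setP=> A; rewrite !inE; apply: eq_existsb => B; rewrite Eel.
by congr (_ && _); apply: eq_forallb => A'; apply: eq_forallb => B'; rewrite Eel.
Qed.

Definition stable (M : voting_method) (V C : finType) (P : profile V C) (A : C)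
    : Prop :=
  exists B : C, beats P A B /\ A \in winners_without (@M V) P B.

Definition stability_for_winners_with_tiebreaking (M : voting_method) : Prop :=
  forall (V C : finType) (P : profile V C), (0 < #|C|)%N ->
    (exists A : C, stable M P A) ->
    forall A : C, A \in M V C P -> stable M P A.

(* Main.v *)
(* If A beats B, the one-step path from A to B already shows that B does not
   defeat A, so a stable candidate yields an eligible match of positive margin.
   The maximal eligible margin is then positive, whence every winner is stable. *)
Require Import Defs.
From mathcomp Require Import all_boot all_order all_algebra.

Set Implicit Arguments.
Unset Strict Implicit.
Unset Printing Implicit Defensive.

Import Order.TTheory GRing.Theory Num.Theory.
Local Open Scope ring_scope.

Lemma marginC (V C : finType) (P : profile V C) (A B : C) :
  margin P B A = - margin P A B.
Proof. by rewrite /margin opprB. Qed.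

Lemma beats_not_defeats (V C : finType) (P : profile V C) (A B : C) :
  beats P A B -> ~~ defeats P B A.
Proof.
rewrite /beats /defeats negbK => AB; apply: connect1.
(* With [m = margin P A B] positive, the bound required of the single edge is [- m <= m]. *)
by rewrite /= marginC ge0_cp // ltW.
Qed.

Lemma winners_without_neq (M : voting_method) (V C : finType)
    (P : profile V C) (A B : C) :
  A \in winners_without (@M V) P B -> A != B.
Proof. by case/imsetP=> x _ ->; apply: (valP x). Qed.

Lemma stable_eligible (M : voting_method) (V C : finType)
    (P : profile V C) (A B : C) :
  beats P A B -> A \in winners_without (@M V) P B -> eligible (@M V) P A B.
Proof.
move=> AB winA; apply/and3P; split=> //; last exact: beats_not_defeats.
exact: winners_without_neq winA.
Qed.

Theorem proposition3 : stability_for_winners_with_tiebreaking SV.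
Proof.
move=> V C P C_gt0 [A [B [AB winA]]] A'; rewrite SVE //.
case: eqP => [C1 _|_].
  (* A single candidate is impossible here: the stability of [A] supplies an opponent [B] distinct
     from [A]. *)
  have /fintype_le1P/(_ A B) eqAB : (#|C| <= 1)%N by rewrite C1.
  by case/eqP: (winners_without_neq winA).
(* The match of [A'] vs. [B'] has maximal margin among eligible matches; this is compared with the
   match of [A] vs. [B]. *)
rewrite inE => /existsP[B' /andP[/and3P[_ winA' _] /forallP/(_ A)/forallP/(_ B)]].
rewrite stable_eligible //= => le_margin.
by exists B'; split=> //; apply: lt_le_trans AB le_margin.
Qed.
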